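(* Let $n\geq 9$ and let $G$ be a finite simple graph of order $n$ with diameter $2$. Then $W(G)>E_1(G)$.
   Context: $W(G)=\sum_{\{u,v\}\subseteq V(G)} d_G(u,v)$ is the Wiener index. For $v\in V(G)$, $\varepsilon_G(v)=\max_u d_G(v,u)$ is the eccentricity, and $E_1(G)=\sum_{v\in V(G)}\varepsilon_G(v)^2$. *)

(* Defs.v *)
From mathcomp Require Import all_boot.

Set Implicit Arguments.
Unset Strict Implicit.
Unset Printing Implicit Defensive.

Section Distance.

Variables (T : finType) (e : rel T).

Definition walk_of_length (u v : T) (k : nat) : bool :=
  [exists p : k.-tuple T, path e u p && (last u p == v)].

(* The least length of a walk from u to v. Shortest walks have fewer than #|T| *)
(* edges, so it suffices to search below #|T|; the junk value #|T| is taken    *)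
(* exactly when v is unreachable from u (see dist_ltn and distP).              *)
Definition dist (u v : T) : nat := find (walk_of_length u v) (iota 0 #|T|).

Definition ecc (v : T) : nat := \max_(u : T) dist v u.

Definition diam : nat := \max_(v : T) ecc v.

Definition connected_graph : Prop := forall u v : T, connect e u v.

(* A disconnected graph has infinite diameter, hence no diameter in nat. *)
Definition has_diameter (d : nat) : Prop := connected_graph /\ diam = d.

(* Each unordered pair {u, v} of distinct vertices is listed once, with u      *)
(* before v in the enumeration of T.                                           *)
Definition wiener : nat :=
  \sum_(u : T) \sum_(v : T | enum_rank u < enum_rank v) dist u v.

Definition E1 : nat := \sum_(v : T) ecc v ^ 2.

Lemma walk_of_lengthP u v k :
  reflect (exists p : seq T, [/\ size p = k, path e u p & last u p = v])
          (walk_of_length u v k).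
Proof.
apply: (iffP existsP) => [[p /andP[ep /eqP lp]]|[p [sp ep lp]]].
  by exists p; rewrite size_tuple.
have sp' : size p == k by apply/eqP.
by exists (Tuple sp'); rewrite /= ep lp eqxx.
Qed.

Lemma dist_ltn u v : (dist u v < #|T|) = connect e u v.
Proof.
rewrite /dist -[X in _ < X](size_iota 0) -has_find.
apply/hasP/idP => [[k _ /walk_of_lengthP[p [_ ep lp]]]|/connectP[p ep ->]].
  by apply/connectP; exists p.
case/shortenP: ep => q eq uq _; exists (size q).
  rewrite mem_iota /= add0n -[(size q).+1]/(size (u :: q)).
  by rewrite -(card_uniqP uq) max_card.
by apply/walk_of_lengthP; exists q.
Qed.

Lemma distP u v : connect e u v ->
  walk_of_length u v (dist u v) /\
  forall k, walk_of_length u v k -> dist u v <= k.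
Proof.
move=> uv; have lt : dist u v < #|T| by rewrite dist_ltn.
split.
  have := @nth_find _ 0 (walk_of_length u v) (iota 0 #|T|).
  rewrite has_find size_iota -/(dist u v) lt => /(_ isT).
  by rewrite nth_iota.
move=> k wk; rewrite leqNgt; apply/negP => ltk.
have := before_find 0 ltk; rewrite nth_iota ?(ltn_trans ltk) //.
by rewrite add0n wk.
Qed.

End Distance.

(* Main.v *)
Require Import Defs.
From mathcomp Require Import all_boot.
From mathcomp Require Import zify.

(** Distinct vertices are at distance at least 1 and some pair is at distance
    2, so W(G) > n(n-1)/2; every eccentricity is at most 2, so E_1(G) <= 4n.
    For n >= 9 one has 4n <= n(n-1)/2. *)

(** The comparison is made after doubling, where ordered pairs replace unordered ones:
    [double_wiener_gt] and [E1_le_diam] give 2W > n(n-1) >= 8n >= 2E_1. *)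

Lemma walk_of_length_sym (T : finType) (e : rel T) (u v : T) (k : nat) :
  symmetric e -> walk_of_length e u v k = walk_of_length e v u k.
Proof.
move=> e_sym.
suff sub x y : walk_of_length e x y k -> walk_of_length e y x k.
  by apply/idP/idP; apply: sub.
case/walk_of_lengthP=> p [sp ep lp]; apply/walk_of_lengthP.
(* The reversed walk starts at [y], so [y] is dropped from the listed vertices and [x] becomes the
   last one. *)
exists (rev (belast x p)); split; first by rewrite size_rev size_belast.
  rewrite -lp rev_path (@eq_path _ _ e) // => a b; exact: e_sym.
by case: p lp {sp ep} => //= a p _; rewrite rev_cons last_rcons.
Qed.

Lemma dist_sym (T : finType) (e : rel T) (u v : T) :
  symmetric e -> dist e u v = dist e v u.
Proof. by move=> e_sym; apply: eq_find => k; apply: walk_of_length_sym. Qed.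

Lemma dist_gt0 (T : finType) (e : rel T) (u v : T) :
  connect e u v -> u != v -> 0 < dist e u v.
Proof.
move=> /distP[/walk_of_lengthP[p [sp _ lp]] _]; apply: contraNT.
by rewrite -eqn0Ngt -sp size_eq0 -lp => /eqP ->.
Qed.

(** By symmetry of [dist], one copy of W can be summed over the pairs in reverse enumeration order;
    the two copies then cover each ordered pair once. *)
Lemma double_wiener (T : finType) (e : rel T) :
  symmetric e ->
  wiener e + wiener e = \sum_(u : T) \sum_(v : T | u != v) dist e u v.
Proof.
move=> e_sym; have -> : wiener e + wiener e = wiener e +
    \sum_(u : T) \sum_(v : T | enum_rank v < enum_rank u) dist e u v.
  congr (_ + _); rewrite /wiener (exchange_big_dep predT) //=.
  by apply: eq_bigr => u _; apply: eq_bigr => v _; apply: dist_sym.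
rewrite /wiener -big_split /=; apply: eq_bigr => u _.
rewrite [RHS](bigID (fun v : T => enum_rank u < enum_rank v)) /=.
congr (_ + _); apply: eq_bigl => v;
  by rewrite -(inj_eq enum_rank_inj) -val_eqE /=; lia.
Qed.

(** Each of the n(n-1) ordered pairs contributes at least 1; the pair [(u, v)] contributes at least
    2, whence strictness. *)
Lemma double_wiener_gt (T : finType) (e : rel T) (u v : T) :
  symmetric e -> connected_graph e -> 1 < dist e u v -> u != v ->
  #|T| * #|T|.-1 < wiener e + wiener e.
Proof.
move=> e_sym e_conn uv2 neq_uv; rewrite double_wiener //.
have row x : \sum_(y : T | x != y) 1 = #|T|.-1.
  rewrite sum1_card -(cardC1 x); apply: eq_card => y.
  by rewrite !inE eq_sym.
have row_le x : #|T|.-1 <= \sum_(y : T | x != y) dist e x y.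
  by rewrite -(row x); apply: leq_sum => y; apply: dist_gt0.
(* Row [u] is isolated and [addSn] charges the strict inequality to it alone; the same is then done
   with entry [v] of that row. *)
rewrite -sum_nat_const (bigD1 u) //= [X in _ < X](bigD1 u) //= -addSn.
apply: leq_add; last exact: leq_sum.
rewrite -(row u) (bigD1 v) //= [X in _ < X](bigD1 v) //= -addSn.
apply: leq_add => //; apply: leq_sum => y /andP[neq_uy _]; exact: dist_gt0.
Qed.

Lemma E1_le_diam (T : finType) (e : rel T) : E1 e <= #|T| * diam e ^ 2.
Proof.
rewrite /E1 -sum_nat_const; apply: leq_sum => v _.
by rewrite leq_sqr; apply: leq_bigmax.
Qed.

(** Both nested maxima range over a nonempty finite type, so they are attained. *)
Lemma dist_diam (T : finType) (e : rel T) :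
  0 < #|T| -> exists u v : T, dist e u v = diam e.
Proof.
move=> T_gt0; have [u ->] : {u | diam e = ecc e u} by apply: eq_bigmax.
have [v ->] : {v | ecc e u = dist e u v} by apply: eq_bigmax.
by exists u, v.
Qed.

Theorem theorem2p5 (n : nat) (T : finType) (e : rel T)
    (e_sym : symmetric e) (e_irr : irreflexive e)
    (n_ge9 : 9 <= n) (order_n : #|T| = n) (diam2 : has_diameter e 2) :
  wiener e > E1 e.
Proof.
have [e_conn diam_eq2] := diam2.
have T_gt0 : 0 < #|T| by lia.
have [u [v dist_uv]] := dist_diam T e T_gt0; rewrite diam_eq2 in dist_uv.
have neq_uv : u != v.
  (* If [u = v], the empty walk would force the distance 2 down to 0. *)
  apply/eqP => eq_uv; have [_ /(_ 0)] := distP (e_conn u v).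
  have walk0 : walk_of_length e u v 0 by apply/walk_of_lengthP; exists [::].
  by move=> /(_ walk0); rewrite dist_uv.
have W_gt : #|T| * #|T|.-1 < wiener e + wiener e.
  by apply: (@double_wiener_gt _ _ u v) => //; rewrite dist_uv.
(* Here n >= 9 gives n(n-1) >= 8n, with equality at n = 9, where the strictness of [W_gt] is
   essential. *)
have := E1_le_diam T e; rewrite diam_eq2 order_n in W_gt *; nia.
Qed.
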